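(* Let $(n_0,\ldots,n_m)$ be a narrowing architecture, i.e. $n_i>n_{i+1}$ for all $i=0,\ldots,m-1$. Then $$\dim_{\mathrm{fun}}\left(\mathcal{P}_{n_0,\ldots,n_m}\right) = n_m+\sum_{i=0}^{m-1} n_i n_{i+1}.$$
   Context: An architecture is a tuple $(n_0,\ldots,n_m)$ of positive integers with $m\ge 1$. Let $\sigma$ denote the map applying $t\mapsto\max\{0,t\}$ to each coordinate of a vector in any $\mathbb{R}^n$. Put $D(n_0,\ldots,n_m)=\sum_{i=1}^m n_i(n_{i-1}+1)$ and $\mathcal{P}_{n_0,\ldots,n_m}=\mathbb{R}^{D(n_0,\ldots,n_m)}$ (parameter space). A parameter $\theta\in\mathcal{P}_{n_0,\ldots,n_m}$ is identified with a list of matrices $[A^i]$ of size $n_i\times(n_{i-1}+1)$, $1\le i\le m$, giving affine maps $A^i:\mathbb{R}^{n_{i-1}}\to\mathbb{R}^{n_i}$, $A^i(x)=[A^i][x,1]^T$. The realization map $\rho$ sends $\theta$ to the function $\rho(\theta)=\sigma\circ A^m\circ\cdots\circ\sigma\circ A^1:\mathbb{R}^{n_0}\to\mathbb{R}^{n_m}$. Let $\mathcal{F}(\theta,x)=\rho(\theta)(x)$. A point $x\in\mathbb{R}^{n_0}$ is parametrically smooth for $\theta$ if $\mathcal{F}:\mathcal{P}_{n_0,\ldots,n_m}\times\mathbb{R}^{n_0}\to\mathbb{R}^{n_m}$ is $C^\infty$ at $(\theta,x)$ (i.e. on a neighborhood of it). A finite set $Z\subset\mathbb{R}^{n_0}$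 is parametrically smooth for $\theta$ if all its points are. A parameter $\theta$ is ordinary if at least one point of $\mathbb{R}^{n_0}$ is parametrically smooth for $\theta$. For a finite ordered set $Z=\{z_1,\ldots,z_k\}\subset\mathbb{R}^{n_0}$, the evaluation map $E_Z:\mathcal{P}_{n_0,\ldots,n_m}\to\mathbb{R}^{k n_m}$ is $E_Z(\theta)=(\rho(\theta)(z_1),\ldots,\rho(\theta)(z_k))$, and $\mathbf{J}E_Z|_\theta$ is its Jacobian matrix with respect to the parameter coordinates at $\theta$. The functional dimension of an ordinary parameter $\theta$ is $$\dim_{\mathrm{fun}}(\theta)=\sup\{\operatorname{rank}\mathbf{J}E_Z|_\theta : Z\subset\mathbb{R}^{n_0}\text{ finite and parametrically smooth for }\theta\},$$ and the functional dimension of parameter space is $\dim_{\mathrm{fun}}(\mathcal{P}_{n_0,\ldots,n_m})=\sup\{\dim_{\mathrm{fun}}(\theta):\theta\in\mathcal{P}_{n_0,\ldots,n_m}\text{ ordinary}\}$. *)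

(* Defs.v *)
From mathcomp Require Import all_boot all_order all_algebra.
From mathcomp Require Import all_classical all_reals all_analysis.

Set Implicit Arguments.
Unset Strict Implicit.
Unset Printing Implicit Defensive.

Import Order.TTheory GRing.Theory Num.Theory.
Import numFieldNormedType.Exports.

Local Open Scope classical_set_scope.
Local Open Scope ring_scope.

(* An architecture (n_0, ..., n_m) is given by m and a function n : nat -> nat,
   of which only the values n 0, ..., n m are ever used. *)
Definition architecture (m : nat) (n : nat -> nat) : Prop :=
  (1 <= m)%N /\ forall i, (i <= m)%N -> (0 < n i)%N.

Definition narrowing (m : nat) (n : nat -> nat) : Prop :=
  forall i, (i < m)%N -> (n i.+1 < n i)%N.

Definition param_dim (m : nat) (n : nat -> nat) : nat :=
  \sum_(i < m) n i.+1 * (n i + 1).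

(* C^k on U, for U open and V, W finite-dimensional, where asking that all the
   directional derivatives of a differentiable f be C^k is the same as asking
   that x |-> 'd f x be C^k. As U is open, the values of 'D_v f outside U
   are irrelevant. *)
Fixpoint Ck_on (R : realType) (V W : normedModType R) (U : set V) (k : nat)
    (f : V -> W) : Prop :=
  match k with
  | 0 => forall x, U x -> {for x, continuous f}
  | k'.+1 => (forall x, U x -> differentiable f x) /\
             (forall v : V, Ck_on U k' ('D_v f))
  end.

Definition smooth_at (R : realType) (V W : normedModType R) (f : V -> W)
    (p : V) : Prop :=
  exists U : set V, open_nbhs p U /\ forall k, Ck_on U k f.

Section Networks.
Variables (R : realType) (m : nat) (n : nat -> nat).

Local Notation params := 'rV[R]_(param_dim m n).

(* The matrix [A^(i+1)], of size n_(i+1) x (n_i + 1): the coordinates of theta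
   are cut into m consecutive blocks, each read as a matrix in row-major order. *)
Definition layer (theta : params) (i : 'I_m) : 'M[R]_(n i.+1, n i + 1) :=
  vec_mx (submxrow (q_ := fun i : 'I_m => (n i.+1 * (n i + 1))%N) theta i).

Definition affine_map (a b : nat) (A : 'M[R]_(b, a + 1)) (x : 'cV[R]_a) :
    'cV[R]_b :=
  A *m col_mx x 1%:M.

Definition relu (a : nat) (x : 'cV[R]_a) : 'cV[R]_a :=
  map_mx (Num.max 0) x.

(* sigma o A^k o ... o sigma o A^1; the proof of (j < m) needed to index the
   layers is, by definition of <, the proof of (j.+1 <= m). *)
Fixpoint network_upto (theta : params) (x : 'cV[R]_(n 0)) (k : nat) :
    (k <= m)%N -> 'cV[R]_(n k) :=
  match k with
  | 0 => fun _ => x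
  | j.+1 => fun lt_jm : (j < m)%N =>
      relu (affine_map (layer theta (Ordinal lt_jm))
                       (network_upto theta x (ltnW lt_jm)))
  end.

Definition realization (theta : params) (x : 'cV[R]_(n 0)) : 'cV[R]_(n m) :=
  network_upto theta x (leqnn m).

Definition param_smooth (theta : params) (x : 'cV[R]_(n 0)) : Prop :=
  smooth_at (fun p : params * 'cV[R]_(n 0) => realization p.1 p.2) (theta, x).

Definition ordinary (theta : params) : Prop :=
  exists x : 'cV[R]_(n 0), param_smooth theta x.

(* The concatenation of the k vectors rho(theta)(z_i), as a point of R^(k n_m). *)
Definition eval_map (k : nat) (Z : k.-tuple 'cV[R]_(n 0)) (theta : params) :
    'rV[R]_(k * n m) :=
  mxvec (\matrix_(i < k, j < n m) realization theta (tnth Z i) j 0).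

(* The library's [jacobian] acts on row vectors: it is the transpose of the
   usual Jacobian matrix, and has the same rank. *)
Definition dim_fun (theta : params) : \bar R :=
  ereal_sup [set r | exists (k : nat) (Z : k.-tuple 'cV[R]_(n 0)),
    [/\ uniq Z, forall z, z \in Z -> param_smooth theta z &
        r = ((\rank (jacobian (eval_map Z) theta))%:R)%:E]].

Definition dim_fun_space : \bar R :=
  ereal_sup [set dim_fun theta | theta in [set theta | ordinary theta]].

End Networks.

(* Main.v *)
(* Upper bound.  The ReLU is positively homogeneous, so multiplying the incoming
   row of a hidden neuron by a factor 1 + h > 0 has the same effect as multiplying
   its outgoing column by 1 + h; the difference of these two directions is in the
   kernel of every Jacobian.  When all hidden biases are nonzero, these kernel
   vectors, one per hidden neuron, are linearly independent, because their
   coordinates on the hidden biases form an invertible diagonal matrix.  The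
   general case follows since such parameters are dense and the rank is lower
   semicontinuous.

   Lower bound.  For a well-chosen parameter (the "staircase"), a direction v that
   does not move the hidden biases and lies in the kernel of all Jacobians is 0.
   Since the layers narrow, any positive activation vector of layer k is attained with all
   previous neurons on.  Layer by layer, compare the derivative along v on both
   sides of the wall where one neuron switches: the jump, which vanishes, is the
   variation of the input of that neuron, transported to the output by
   nonnegative matrices without zero columns.  Hence the variation of the row of
   that neuron vanishes on an open part of an affine hyperplane that misses the
   origin, so it is zero.  For the last layer no wall is needed. *)
Require Import Defs.
From HB Require Import structures.
From mathcomp Require Import all_boot all_order all_algebra.
From mathcomp Require Import all_classical all_reals all_analysis.
From mathcomp Require Import zify ring lra.

Set Implicit Arguments.
Unset Strict Implicit.
Unset Printing Implicit Defensive.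

Import Order.TTheory GRing.Theory Num.Theory.
Import numFieldNormedType.Exports.

Local Open Scope classical_set_scope.
Local Open Scope ring_scope.

(** * Polynomial maps are smooth *)

Section Smooth.
Variables (R : realType) (V : normedModType R).

(** The first-order expansion of [f] at [x] is one for [g] too, since the two agree near [x];
    uniqueness of the differential concludes. *)
Lemma near_eq_differentiable (W : normedModType R) (f g : V -> W) (x : V) :
  (\near x, f x = g x) -> differentiable f x -> differentiable g x.
Proof.
move=> fg df; have fgx : f x = g x by exact: nbhs_singleton fg.
have eg : g \o shift x = cst (g x) + 'd f x +o_ 0 id.
  apply/eqaddoP => e e0.
  have /eqaddoP/(_ e e0) dfe := diff_locally df.
  have fg0 : \forall h \near (0 : V), f (h + x) = g (h + x).
    by move: fg; rewrite (near_shift 0) => fg; apply: filterS fg => h /=; rewrite subr0.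
  near=> h; rewrite [X in `|X|](_ : _ = (f \o shift x - (cst (f x) + 'd f x)) h).
    by near: h.
  have -> : (g \o shift x - (cst (g x) + 'd f x)) h = g (h + x) - (g x + 'd f x h) by [].
  by rewrite -fgx -(near fg0 h).
have dfc : continuous ('d f x) by exact: diff_continuous.
by apply/diff_locallyP; rewrite (diff_unique dfc eg).
Unshelve. all: by end_near. Qed.

Lemma Ck_on_eq (W : normedModType R) (U : set V) (f g : V -> W) (k : nat) :
  open U -> (forall x, U x -> f x = g x) -> Ck_on U k f -> Ck_on U k g.
Proof.
move=> oU; elim: k f g => [|k IH] f g fg /=; last first.
  move=> [df Df]; have nfg x : U x -> \near x, f x = g x.
    by move=> Ux; apply: filterS (open_nbhs_nbhs (conj oU Ux)); exact: fg.
  split=> [x Ux|v]; first exact: near_eq_differentiable (nfg x Ux) (df x Ux).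
  by apply: IH (Df v) => x Ux; apply: near_eq_derive; exact: nfg.
move=> cf x Ux.
have nfg : \near x, f x = g x.
  by apply: filterS (open_nbhs_nbhs (conj oU Ux)); exact: fg.
have := cf x Ux; rewrite /prop_for /continuous_at (fg _ Ux).
by apply: cvg_trans; exact: near_eq_cvg.
Qed.

(** A syntactic class stable under directional derivatives: by induction on [k], each member
    satisfies [Ck_on] for every [k]. *)
Inductive polynomial_fun : (V -> R) -> Prop :=
| polynomial_cst (c : R) : polynomial_fun (cst c)
| polynomial_lin (f : {linear V -> R}) : continuous f -> polynomial_fun f
| polynomialD f g : polynomial_fun f -> polynomial_fun g -> polynomial_fun (f + g)
| polynomialM f g : polynomial_fun f -> polynomial_fun g -> polynomial_fun (f * g).

Lemma polynomial_differentiable f x : polynomial_fun f -> differentiable f x.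
Proof.
elim=> {f} [c|f cf|f g _ df _ dg|f g _ df _ dg].
- exact: differentiable_cst.
- exact: linear_differentiable.
- exact: differentiableD.
- exact: differentiableM.
Qed.

Lemma polynomial_continuous f : polynomial_fun f -> continuous f.
Proof.
by move=> pf x; apply: differentiable_continuous; exact: polynomial_differentiable.
Qed.

Lemma polynomial_derive f v : polynomial_fun f -> polynomial_fun ('D_v f).
Proof.
elim=> {f} [c|f cf|f g pf Df pg Dg|f g pf Df pg Dg].
- rewrite (_ : 'D_v _ = cst 0); first exact: polynomial_cst.
  by apply/funext => x; rewrite derive_cst.
- rewrite (_ : 'D_v f = cst (f v)); first exact: polynomial_cst.
  apply/funext => x; rewrite deriveE ?diff_lin//.
  exact: linear_differentiable.
- rewrite (_ : 'D_v _ = 'D_v f + 'D_v g); first exact: polynomialD.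
  apply/funext => x; rewrite deriveD//; apply: diff_derivable;
    exact: polynomial_differentiable.
- rewrite (_ : 'D_v _ = f * 'D_v g + g * 'D_v f).
    by apply: polynomialD; exact: polynomialM.
  apply/funext => x; rewrite deriveM//; apply: diff_derivable;
    exact: polynomial_differentiable.
Qed.

Definition polynomial_map d (f : V -> 'cV[R]_d) :=
  forall j, polynomial_fun (fun x => f x j 0).

Lemma polynomial_map_differentiable d (f : V -> 'cV[R]_d) x :
  polynomial_map f -> differentiable f x.
Proof.
move=> pf.
have -> : f = \sum_(j < d) (fun x => f x j 0 *: delta_mx j 0).
  apply/funext => y; rewrite fct_sumE; apply/colP => i.
  rewrite summxE (bigD1 i)//= !mxE !eqxx mulr1 big1 ?addr0// => j ji.
  by rewrite !mxE eq_sym (negbTE ji) mulr0.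
apply: differentiable_sum => j; apply: differentiableZl.
exact: polynomial_differentiable.
Qed.

Lemma polynomial_map_derive d (f : V -> 'cV[R]_d) v :
  polynomial_map f -> polynomial_map ('D_v f).
Proof.
move=> pf j; rewrite (_ : (fun _ => _) = 'D_v (fun x => f x j 0)).
  exact: polynomial_derive.
apply/funext => x; rewrite derive_mx ?mxE//; apply: diff_derivable.
exact: polynomial_map_differentiable.
Qed.

Lemma polynomial_map_Ck d (f : V -> 'cV[R]_d) U k :
  polynomial_map f -> Ck_on U k f.
Proof.
elim: k f => [|k IH] f pf /=.
  move=> x _; apply: differentiable_continuous.
  exact: polynomial_map_differentiable.
split=> [x _|v]; first exact: polynomial_map_differentiable.
exact/IH/polynomial_map_derive.
Qed.
End Smooth.

(** * Networks with a prescribed activation pattern *)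

Section Networks.
Variables (R : realType) (m : nat) (n : nat -> nat).

Local Notation params := 'rV[R]_(param_dim m n).
Local Notation input := 'cV[R]_(n 0).

(* Indexing the layers by plain naturals avoids the dependent types of
   [network_upto]; the value is [0] for [k >= m]. *)
Definition weight (k : nat) (theta : params) : 'M[R]_(n k.+1, n k + 1) :=
  match @idP (k < m)%N with
  | ReflectT lt_km => layer theta (Ordinal lt_km)
  | ReflectF _ => 0
  end.

Lemma weightE (theta : params) (i : 'I_m) : weight i theta = layer theta i.
Proof.
case: i => i lt_im; rewrite /weight /=; case: {-}_ / idP => // lt_im'.
by rewrite (bool_irrelevance lt_im' lt_im).
Qed.

Fact weight_is_linear k : linear (@weight k).
Proof.
move=> a u v; rewrite /weight; case: {-}_ / idP => [lt_km|_].
  by rewrite -linearP; congr vec_mx; apply/rowP => j; rewrite !mxE.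
by rewrite scaler0 addr0.
Qed.

HB.instance Definition _ k :=
  GRing.isLinear.Build R params 'M[R]_(n k.+1, n k + 1) *:%R (@weight k)
    (@weight_is_linear k).

Lemma weight_inj (theta theta' : params) :
  (forall k, (k < m)%N -> weight k theta = weight k theta') -> theta = theta'.
Proof.
move=> eqw; rewrite -(submxrowK (q_ := fun i : 'I_m => (n i.+1 * (n i + 1))%N) theta).
rewrite -(submxrowK theta'); apply: eq_mxrow => i; apply: (can_inj vec_mxK).
by have := eqw i (ltn_ord i); rewrite !weightE.
Qed.

Definition of_weights (A : forall k, 'M[R]_(n k.+1, n k + 1)) : params :=
  \mxrow_(i < m) mxvec (A i).

Lemma of_weightsK A k : (k < m)%N -> weight k (of_weights A) = A k.
Proof.
move=> lt_km; rewrite (weightE _ (Ordinal lt_km)) /layer.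
by rewrite /of_weights mxrowK mxvecK.
Qed.

Fixpoint net (theta : params) (x : input) (k : nat) : 'cV[R]_(n k) :=
  match k with
  | 0 => x
  | k'.+1 => relu (affine_map (weight k' theta) (net theta x k'))
  end.

Lemma network_uptoE theta x k (le_km : (k <= m)%N) :
  network_upto theta x le_km = net theta x k.
Proof.
elim: k le_km => //= k IH lt_km.
by rewrite IH (weightE _ (Ordinal lt_km)).
Qed.

Lemma realizationE theta x : realization theta x = net theta x m.
Proof. exact: network_uptoE. Qed.

Lemma affine_mapE (a b : nat) (A : 'M[R]_(b, a + 1)) (x : 'cV[R]_a) j i :
  affine_map A x j i =
    \sum_(l < a) A j (lshift 1 l) * x l i + A j (rshift a 0).
Proof.
rewrite ord1 /affine_map mxE big_split_ord /= big_ord1 col_mxEd mxE eqxx mulr1.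
by congr (_ + _); apply: eq_bigr => l _; rewrite col_mxEu.
Qed.

(* Neuron [j] of layer [k.+1] is on iff [s k j], whatever the sign of its input,
   so that the result is polynomial in the parameters and the input. *)
Fixpoint mnet (s : nat -> nat -> bool) (p : params * input) (k : nat) :
    'cV[R]_(n k) :=
  match k with
  | 0 => p.2
  | k'.+1 => \col_j ((s k' j)%:R * affine_map (weight k' p.1) (mnet s p k') j 0)
  end.

Definition preact s (p : params * input) k : 'cV[R]_(n k.+1) :=
  affine_map (weight k p.1) (mnet s p k).

Lemma mnetS s p k j : mnet s p k.+1 j 0 = (s k j)%:R * preact s p k j 0.
Proof. by rewrite /= mxE. Qed.

Lemma polynomial_sum (V : normedModType R) (I : Type) (r : seq I) (F : I -> V -> R) :
  (forall i, polynomial_fun (F i)) ->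
  polynomial_fun (fun x => \sum_(i <- r) F i x).
Proof.
move=> pF; elim: r => [|i r IH].
  rewrite (_ : (fun _ => _) = cst 0); first exact: polynomial_cst.
  by apply/funext => x; rewrite big_nil.
rewrite (_ : (fun _ => _) = F i + (fun x => \sum_(i <- r) F i x)).
  exact: polynomialD.
by apply/funext => x; rewrite big_cons.
Qed.

Lemma polynomial_weight k i j :
  polynomial_fun (fun p : params * input => weight k p.1 i j).
Proof.
rewrite /weight; case: {-}_ / idP => [lt_km|_]; last first.
  rewrite (_ : (fun _ => _) = cst 0); first exact: polynomial_cst.
  by apply/funext => p; rewrite mxE.
(* The entry [(i, j)] of layer [k] is the coordinate of [theta] at position [a], hence continuous
   and linear. *)
pose a := @tagnat.Rank m (fun i : 'I_m => (n i.+1 * (n i + 1))%N)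
  (Ordinal lt_km) (mxvec_index i j).
pose f (p : params * input) := p.1 0 a.
have flin : linear f by move=> c u v; rewrite /f !mxE.
pose fM := GRing.isLinear.Build _ _ _ _ _ flin.
pose fL : {linear _ -> _} := HB.pack f fM.
have fc : continuous fL.
  move=> p; apply: (@continuous_comp _ _ _ fst (fun M : params => M 0 a)).
    exact: cvg_fst.
  exact: coord_continuous.
rewrite (_ : (fun _ => _) = fL); first exact: polynomial_lin fc.
by apply/funext => p; rewrite /layer !mxE.
Qed.

Lemma polynomial_input j : polynomial_fun (fun p : params * input => p.2 j 0).
Proof.
pose f (p : params * input) := p.2 j 0.
have flin : linear f by move=> c u v; rewrite /f !mxE.
pose fM := GRing.isLinear.Build _ _ _ _ _ flin.
pose fL : {linear _ -> _} := HB.pack f fM.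
have fc : continuous fL.
  move=> p; apply: (@continuous_comp _ _ _ snd (fun M : input => M j 0)).
    exact: cvg_snd.
  exact: coord_continuous.
exact: polynomial_lin fc.
Qed.

Lemma polynomial_affine k (h : params * input -> 'cV[R]_(n k)) :
  polynomial_map h -> polynomial_map (fun p => affine_map (weight k p.1) (h p)).
Proof.
move=> ph j.
rewrite (_ : (fun _ => _) = (fun p : params * input =>
  \sum_(l < n k) weight k p.1 j (lshift 1 l) * h p l 0) +
  (fun p : params * input => weight k p.1 j (rshift (n k) 0))); last first.
  by apply/funext => p; rewrite affine_mapE.
apply: polynomialD; last exact: polynomial_weight.
apply: polynomial_sum => l.
exact: (polynomialM (polynomial_weight j (lshift 1 l)) (ph l)).
Qed.

Lemma polynomial_mnet s k : polynomial_map (mnet s ^~ k).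
Proof.
elim: k => [|k IH] j /=; first exact: polynomial_input.
rewrite (_ : (fun _ => _) = cst (s k j)%:R *
  (fun p => affine_map (weight k p.1) (mnet s p k) j 0)).
  by apply: polynomialM (polynomial_cst _ _) _; exact: polynomial_affine.
by apply/funext => p; rewrite mxE.
Qed.

Lemma polynomial_preact s k : polynomial_map (preact s ^~ k).
Proof. exact/polynomial_affine/polynomial_mnet. Qed.

Definition signed (b : bool) (y : R) : R := if b then y else - y.

(** Strict inequalities make this set open, and on it the network coincides with the polynomial
    [mnet s]; all its points are therefore parametrically smooth. *)
Definition pattern (s : nat -> nat -> bool) : set (params * input) :=
  [set p | forall (k : 'I_m) (j : 'I_(n k.+1)), 0 < signed (s k j) (preact s p k j 0)].

Lemma mnet_pattern s p k : (k <= m)%N -> pattern s p -> mnet s p k = net p.1 p.2 k.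
Proof.
move=> le_km sp; elim: k le_km => //= k IH lt_km.
rewrite -(IH (ltnW lt_km)); apply/colP => j; rewrite mxE [RHS]mxE.
have := sp (Ordinal lt_km) j; rewrite /preact /= /signed.
case: (s k j) => [/ltW y0|]; first by rewrite mul1r max_r.
by rewrite oppr_gt0 mul0r => /ltW y0; rewrite max_l.
Qed.

Lemma near_pattern s p : pattern s p -> \forall q \near p, pattern s q.
Proof.
move=> sp.
have cont (k : 'I_m) (j : 'I_(n k.+1)) :
    \forall q \near p, 0 < signed (s k j) (preact s q k j 0).
  have cont : {for p, continuous (fun q => signed (s k j) (preact s q k j 0))}.
    rewrite /signed; have cont := polynomial_continuous (polynomial_preact s j) (x := p).
    by case: (s k j) => //; exact: continuousN.
  exact: (cvgr_gt _ cont _ (sp k j)).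
exact: filter_forall _ (fun k => filter_forall _ (cont k)).
Qed.

Lemma open_pattern s : open (pattern s).
Proof. by rewrite openE => p /near_pattern. Qed.

Lemma pattern_param_smooth s theta x :
  pattern s (theta, x) -> param_smooth theta x.
Proof.
move=> sp; exists (pattern s); split; first by split=> //; exact: open_pattern.
move=> k; apply: (@Ck_on_eq _ _ _ _ (mnet s ^~ m)); first exact: open_pattern.
  by move=> p sp'; rewrite realizationE mnet_pattern.
exact/polynomial_map_Ck/polynomial_mnet.
Qed.

(** The derivative of [mnet s] along [(v, 0)], unfolded by the product rule. The appended [0] is the
    derivative of the constant [1] that multiplies the biases. *)
Fixpoint tangent (s : nat -> nat -> bool) (v : params) (p : params * input)
    (k : nat) : 'cV[R]_(n k) :=
  match k with
  | 0 => 0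
  | k'.+1 => \col_j ((s k' j)%:R *
      (affine_map (weight k' v) (mnet s p k') +
       weight k' p.1 *m col_mx (tangent s v p k') 0) j 0)
  end.

Lemma tangentS s v p k j : tangent s v p k.+1 j 0 = (s k j)%:R *
  (affine_map (weight k v) (mnet s p k) +
   weight k p.1 *m col_mx (tangent s v p k) 0) j 0.
Proof. by rewrite /= mxE. Qed.

Lemma mulmx_col_mx0E (a b : nat) (A : 'M[R]_(b, a + 1)) (x : 'cV[R]_a) j i :
  (A *m col_mx x 0) j i = \sum_(l < a) A j (lshift 1 l) * x l i.
Proof.
rewrite mxE big_split_ord /= [X in _ + X]big1 ?addr0; last first.
  by move=> l _; rewrite col_mxEd mxE mulr0.
by apply: eq_bigr => l _; rewrite col_mxEu.
Qed.

Lemma derive_weight k i j (v : params) (p : params * input) :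
  is_derive p (v, 0 : input) (fun p => weight k p.1 i j) (weight k v i j).
Proof.
apply: DeriveDef.
  apply: diff_derivable; apply: polynomial_differentiable.
  exact: polynomial_weight.
rewrite /derive; apply: cvg_lim => //.
apply: cvg_near_cst; near=> h => /=.
rewrite linearP !mxE addrK [_ *: _]mulrA mulVf ?mul1r//.
by near: h; exact: nbhs_dnbhs_neq.
Unshelve. all: by end_near. Qed.

Lemma derive_mnet s v p k :
  'D_(v, 0) (mnet s ^~ k) p = tangent s v p k.
Proof.
suff H j : is_derive p (v, 0 : input) (fun p => mnet s p k j 0) (tangent s v p k j 0).
  rewrite derive_mx; last first.
    apply: diff_derivable; apply: polynomial_map_differentiable.
    exact: polynomial_mnet.
  by apply/matrixP => j i; rewrite ord1 mxE; exact: derive_val.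
elim: k j => [|k IH] j.
  apply: DeriveDef => /=.
    apply/diff_derivable/polynomial_differentiable/polynomial_input.
  rewrite /derive; apply: cvg_lim => //.
  apply: cvg_near_cst; near=> h => /=.
  by rewrite scaler0 add0r subrr scaler0 mxE.
rewrite (_ : (fun _ => _) = cst (s k j)%:R *
  (\sum_(l < n k) (fun p : params * input => weight k p.1 j (lshift 1 l)) *
      (fun p => mnet s p k l 0) +
  (fun p : params * input => weight k p.1 j (rshift (n k) 0)))); last first.
  apply/funext => q /=; rewrite mxE affine_mapE; congr (_ * (_ + _)).
  by rewrite fct_sumE.
have dw l := derive_weight j (lshift 1 l) v p.
have db := derive_weight j (rshift (n k) 0) v p.
have dn l : is_derive p (v, 0 : input) (fun p => mnet s p k l 0) (tangent s v p k l 0).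
  exact: IH.
apply: is_derive_eq.
rewrite scaler0 addr0 [RHS]mxE [X in _ = _ * X]mxE affine_mapE mulmx_col_mx0E.
congr (_ * _); rewrite addrAC; congr (_ + _); rewrite -big_split /=.
by apply: eq_bigr => l _; rewrite addrC; congr (_ + _); exact: mulrC.
Unshelve. all: by end_near. Qed.

End Networks.

(** * The Jacobian of the evaluation map *)

Lemma cvg_det (R : realType) (T : Type) (F : set_system T) (r : nat)
    (A : T -> 'M[R]_r) (B : 'M[R]_r) : Filter F ->
  (forall i j, A t i j @[t --> F] --> B i j) -> \det (A t) @[t --> F] --> \det B.
Proof.
move=> FF cA; rewrite /determinant.
apply: cvg_big => [|s _]; first exact: add_continuous.
apply: cvgM; first exact: cvg_cst.
apply: cvg_big => [|i _]; first exact: mul_continuous.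
exact: cA.
Qed.

Lemma cvg_mulmx (R : realType) (T : Type) (F : set_system T) (p q r : nat)
    (A : T -> 'M[R]_(p, q)) (A' : T -> 'M[R]_(q, r))
    (B : 'M[R]_(p, q)) (B' : 'M[R]_(q, r)) : Filter F ->
  (forall i j, A t i j @[t --> F] --> B i j) ->
  (forall i j, A' t i j @[t --> F] --> B' i j) ->
  forall i j, (A t *m A' t) i j @[t --> F] --> (B *m B') i j.
Proof.
move=> FF cA cA' i j; rewrite mxE; under eq_cvg do rewrite mxE.
apply: cvg_big => [|s _]; first exact: add_continuous.
by apply: cvgM.
Qed.

(** One-sided inverses [M] and [N] of the factors of a rank factorization turn [B] into an identity
    matrix of size [\rank B]. The determinant of [M *m A t *m N] tends to 1, so some [A t] of rank
    at most [r] has rank at least [\rank B]. *)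
Lemma mxrank_limit (R : realType) (T : Type) (F : set_system T) (p q r : nat)
    (A : T -> 'M[R]_(p, q)) (B : 'M[R]_(p, q)) : ProperFilter F ->
  (forall i j, A t i j @[t --> F] --> B i j) ->
  (\forall t \near F, \rank (A t) <= r)%N -> (\rank B <= r)%N.
Proof.
move=> FF cA rA.
pose M := pinvmx (col_base B); pose N := pinvmx (row_base B).
have MBN : M *m (col_base B *m row_base B) *m N = 1%:M.
  rewrite /M /N mulmxA mulVpmx ?col_base_full// mul1mx.
  by rewrite mulmxVp ?row_base_free.
rewrite mulmx_base in MBN.
have cdet : \det (M *m A t *m N) @[t --> F] --> (1 : R).
  rewrite -(det1 R (\rank B)) -MBN; apply: cvg_det.
  apply: cvg_mulmx => [|i j]; last exact: cvg_cst.
  by apply: cvg_mulmx => // i j; exact: cvg_cst.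
have [t [dt rt]] : exists t, 0 < \det (M *m A t *m N) /\ (\rank (A t) <= r)%N.
  by apply: (@filter_ex _ F); apply: filterI rA; exact: (cvgr_gt _ cdet).
apply: leq_trans rt; rewrite -[X in (X <= _)%N](@mxrank_unit _ _ (M *m A t *m N)).
  by apply: leq_trans (mxrankM_maxl _ _) _; exact: mxrankM_maxr.
by rewrite unitmxE unitfE gt_eqF.
Qed.

Section EvalMap.
Variables (R : realType) (m : nat) (n : nat -> nat).
Local Notation params := 'rV[R]_(param_dim m n).
Local Notation input := 'cV[R]_(n 0).

Lemma derive_realization (v theta : params) (z : input) :
  'D_v ((@realization R m n)^~ z) theta =
  'D_(v, 0) (fun p : params * input => realization p.1 p.2) (theta, z).
Proof.
apply: (congr1 (fun q : R -> 'cV[R]_(n m) => lim (q @ 0^'))).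
apply/funext => h /=.
by rewrite scaler0 add0r.
Qed.

Lemma cvg_slice (theta : params) (z : input) :
  (fun t : params => (t, z)) @ theta --> (theta, z).
Proof.
have cz : (fun _ : params => z) @ theta --> z.
  exact: cst_continuous.
exact: (@cvg_pair _ _ _ (nbhs theta) (nbhs theta) (nbhs z) _ _ _ id _ cvg_id cz).
Qed.

Lemma near_slice (P : set (params * input)) (theta : params) (z : input) :
  (\forall p \near (theta, z), P p) -> \forall theta' \near theta, P (theta', z).
Proof.
by move=> nP; exact: (@cvg_slice theta z).
Qed.

(** Nearby parameters are included because the upper bound is first proved at perturbations of
    [theta]. *)
Lemma param_smooth_differentiable (theta : params) (z : input) :
  param_smooth theta z ->
  \forall theta' \near theta, differentiable ((@realization R m n)^~ z) theta'.
Proof.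
move=> [U [oU /(_ 1)/=[dF _]]].
have : \forall p \near (theta, z),
    differentiable (fun p : params * input => realization p.1 p.2) p.
  by apply: filterS dF _; exact: open_nbhs_nbhs.
move=> /near_slice; apply: filterS => theta' dF'.
have : differentiable (fun t : params => (t, z)) theta'.
  apply: differentiable_pair; last exact: differentiable_cst.
  exact: (ex_diff (is_diff_def := is_diff_id theta')).
by move=> dpair; exact: (differentiable_comp dpair dF').
Qed.

Lemma param_smooth_continuous_derive (theta : params) (z : input) v :
  param_smooth theta z ->
  {for theta, continuous ('D_v ((@realization R m n)^~ z))}.
Proof.
move=> [U [[oU Utz] /(_ 1)/=[_ /(_ (v, 0) _ Utz) cD]]].
rewrite /prop_for /continuous_at derive_realization.
under eq_cvg do rewrite derive_realization.
exact: (cvg_comp _ _ (@cvg_slice theta z) cD).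
Qed.

Lemma eval_mapE k (Z : k.-tuple input) (theta : params) i j :
  eval_map Z theta 0 (mxvec_index i j) = realization theta (tnth Z i) j 0.
Proof. by rewrite /eval_map mxvecE mxE. Qed.

Lemma eval_map_differentiable k (Z : k.-tuple input) (theta : params) :
  (forall z, z \in Z -> differentiable ((@realization R m n)^~ z) theta) ->
  differentiable (eval_map Z) theta.
Proof.
move=> dZ.
have -> : @eval_map R m n k Z = \sum_(i < k) \sum_(j < n m)
    (fun t => realization t (tnth Z i) j 0 *: mxvec (delta_mx i j)).
  apply/funext => t; rewrite fct_sumE /eval_map [X in mxvec X]matrix_sum_delta.
  rewrite linear_sum; apply: eq_bigr => i _.
  rewrite fct_sumE linear_sum; apply: eq_bigr => j _.
  by rewrite linearZ mxE.
apply: differentiable_sum => i; apply: differentiable_sum => j.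
apply: differentiableZl.
apply: (@differentiable_comp _ _ _ _ ((@realization R m n)^~ (tnth Z i))
  (fun M : 'cV[R]_(n m) => M j 0)).
  by apply: dZ; exact: mem_tnth.
exact: differentiable_coord.
Qed.

Lemma mul_jacobian_eval_map k (Z : k.-tuple input) (theta v : params) i j :
  (forall z, z \in Z -> differentiable ((@realization R m n)^~ z) theta) ->
  (v *m jacobian (eval_map Z) theta) 0 (mxvec_index i j) =
  ('D_v ((@realization R m n)^~ (tnth Z i)) theta) j 0.
Proof.
move=> dZ; have dE := eval_map_differentiable dZ.
rewrite -deriveEjacobian// derive_mx; last exact: diff_derivable.
rewrite derive_mx; last by apply: diff_derivable; apply: dZ; exact: mem_tnth.
rewrite !mxE; congr ('D_v _ theta); apply/funext => t.
by rewrite eval_mapE.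
Qed.

End EvalMap.

(** * Upper bound: the scaling symmetries *)

Lemma near_eq_derive_dir (R : realType) (V W : normedModType R) (f : V -> W)
    (a u v : V) :
  (\forall h \near (0 : R)^', f (h *: u + a) = f (h *: v + a)) ->
  'D_u f a = 'D_v f a.
Proof.
move=> E; rewrite /derive; congr (lim _).
rewrite eqEsubset; split; apply: near_eq_cvg; apply: filterS E => h /= E.
  by rewrite E.
by rewrite E.
Qed.

Section UpperBound.
Variables (R : realType) (m : nat) (n : nat -> nat).
Local Notation params := 'rV[R]_(param_dim m n).
Local Notation input := 'cV[R]_(n 0).

(** A neuron of tag [k] is computed by [weight k]; the bound [m.-1] leaves out the output layer,
    which has no outgoing weights. *)
Definition hidden : finType := {k : 'I_m.-1 & 'I_(n k.+1)}.

Lemma hidden_lt (a : hidden) : ((tag a).+1 < m)%N.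
Proof. by rewrite -ltn_predRL. Qed.

Definition bias (theta : params) (k : nat) (j : 'I_(n k.+1)) : R :=
  weight k theta j (rshift (n k) 0).

(** The matrix of the projection onto the hidden biases. It certifies the independence of the
    scaling directions in the upper bound, and its kernel is the test subspace of the lower
    bound. *)
Definition hidden_biases : 'M[R]_(param_dim m n, #|hidden|) :=
  \matrix_(i, a) bias (delta_mx 0 i) (tagged (enum_val a)).

Lemma mul_hidden_biases (theta : params) i a :
  (theta *m hidden_biases) i a = bias theta (tagged (enum_val a)).
Proof.
rewrite ord1 mxE {2}(row_sum_delta theta) /bias linear_sum summxE.
by apply: eq_bigr => l _; rewrite linearZ !mxE.
Qed.

(** Adding [h] times this direction multiplies the incoming row of neuron [j] by [1 + h]; [col_dir]
    does the same to its outgoing column. *)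
Definition row_dir (theta : params) (k : nat) (j : 'I_(n k.+1)) : params :=
  of_weights m (fun k' => \matrix_(a, b)
    (((k' == k) && (a == j :> nat))%:R * weight k' theta a b)).

Definition col_dir (theta : params) (k : nat) (j : 'I_(n k.+1)) : params :=
  of_weights m (fun k' => \matrix_(a, b)
    (((k' == k.+1) && (b == j :> nat))%:R * weight k' theta a b)).

Lemma weight_line (A : forall k, 'M[R]_(n k.+1, n k + 1)) h (theta : params) k a b :
  (k < m)%N ->
  weight k (h *: of_weights m A + theta) a b = h * A k a b + weight k theta a b.
Proof. by move=> lt_km; rewrite linearP /= of_weightsK// mxE [X in X + _]mxE. Qed.

Lemma netS (theta : params) (x : input) k a :
  net theta x k.+1 a 0 = Num.max 0
    (\sum_(l < n k) weight k theta a (lshift 1 l) * net theta x k l 0 + bias theta a).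
Proof. by rewrite /= mxE affine_mapE. Qed.

(* Positive homogeneity of the ReLU. *)
Lemma net_row_col_dir (theta : params) (x : input) k (j : 'I_(n k.+1)) h k' :
  (k' <= m)%N -> -1 < h -> forall a : 'I_(n k'),
  net (h *: row_dir theta j + theta) x k' a 0 =
  (1 + ((k' == k.+1) && (a == j :> nat))%:R * h) *
    net (h *: col_dir theta j + theta) x k' a 0.
Proof.
move=> le_km h1; elim: k' le_km => [|k' IH] lt_km a.
  by rewrite mul0r addr0 mul1r.
have {}IH := IH (ltnW lt_km); rewrite [LHS]netS [X in _ = _ * X]netS eqSS.
set c := (1 + _).
have c0 : 0 <= c by rewrite /c; case: (_ && _); rewrite ?mul1r ?mul0r; lra.
rewrite maxr_pMr// mulr0; congr (Num.max _ _).
rewrite mulrDr big_distrr; congr (_ + _).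
  apply: eq_bigr => b _; rewrite IH /row_dir /col_dir !weight_line// !mxE /c.
  by move: (net _ _ _ _ _) => N /=; ring.
rewrite /bias /row_dir /col_dir !weight_line// !mxE /c.
(* The bias column has index [n k'], beyond every neuron index, so it is not rescaled by
   [col_dir]. *)
have -> : (k' == k.+1) && (rshift (n k') (0 : 'I_1) == j :> nat) = false.
  by apply/negbTE/negP => /andP[/eqP -> /eqP/=]; have := ltn_ord j; lia.
by rewrite mul0r mulr0 add0r; ring.
Qed.

Lemma realization_row_col_dir (theta : params) (x : input) k (j : 'I_(n k.+1)) h :
  (k.+1 < m)%N -> -1 < h ->
  realization (h *: row_dir theta j + theta) x =
  realization (h *: col_dir theta j + theta) x.
Proof.
move=> lt_km h1; rewrite !realizationE; apply/colP => a.
by rewrite net_row_col_dir// gtn_eqF// mul0r addr0 mul1r.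
Qed.

Lemma derive_row_col_dir (theta : params) (x : input) k (j : 'I_(n k.+1)) :
  (k.+1 < m)%N ->
  'D_(row_dir theta j) ((@realization R m n)^~ x) theta =
  'D_(col_dir theta j) ((@realization R m n)^~ x) theta.
Proof.
move=> lt_km.
apply: near_eq_derive_dir.
have : \forall h \near (0 : R)^', `|h| < 1 by exact: dnbhs0_lt.
apply: filterS => h; rewrite ltr_norml => /andP[h1 _].
exact: realization_row_col_dir.
Qed.

Definition scaling_dirs (theta : params) : 'M[R]_(#|hidden|, param_dim m n) :=
  \matrix_a (row_dir theta (tagged (enum_val a)) -
             col_dir theta (tagged (enum_val a))).

Lemma scaling_dirs_jacobian k (Z : k.-tuple input) (theta : params) :
  (forall z, z \in Z -> differentiable ((@realization R m n)^~ z) theta) ->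
  scaling_dirs theta *m jacobian (eval_map Z) theta = 0.
Proof.
move=> dZ; apply/row_matrixP => a; rewrite row_mul rowK row0.
apply/rowP => b; case/mxvec_indexP: b => i j.
rewrite mul_jacobian_eval_map// mxE.
have dz : differentiable ((@realization R m n)^~ (tnth Z i)) theta.
  by apply: dZ; exact: mem_tnth.
rewrite deriveE// linearB /= -!deriveE// derive_row_col_dir ?subrr ?mxE//.
exact: hidden_lt.
Qed.

Lemma scaling_dirs_biases (theta : params) :
  scaling_dirs theta *m hidden_biases =
  diag_mx (\row_a bias theta (tagged (enum_val a))).
Proof.
apply/matrixP => a b.
have -> : (scaling_dirs theta *m hidden_biases) a b =
  (row a (scaling_dirs theta) *m hidden_biases) 0 b by rewrite -row_mul [RHS]mxE.
rewrite rowK mul_hidden_biases !mxE.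
move Eb : (enum_val b) => eb; case: eb Eb => kb jb Eb.
move Ea : (enum_val a) => ea; case: ea Ea => ka ja Ea /=.
have lt_k : (kb < m)%N by exact: ltnW (hidden_lt (existT _ kb jb)).
rewrite /bias linearB /= !of_weightsK// !mxE/=.
(* Column directions do not move biases, so only the row directions contribute. *)
rewrite [X in _ - X](_ : _ = 0) ?subr0; last first.
  apply/eqP; rewrite mulf_eq0 pnatr_eq0 eqb0; apply/orP; left.
  by apply/negP => /andP[/eqP -> /eqP/=]; have := ltn_ord ja; lia.
have [eab|nab] := eqVneq a b.
  move: Eb; rewrite -eab Ea => Eb.
  have Ek : ka = kb by exact: (congr1 tag Eb).
  subst kb; have Ej : ja = jb by exact: eq_from_Tagged Eb.
  by rewrite -Ej !eqxx mul1r.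
rewrite mulr0n; apply/eqP; rewrite mulf_eq0 pnatr_eq0 eqb0; apply/orP; left.
apply/negP => /andP[/eqP Ek /eqP Ej]; case/eqP: nab.
apply: enum_val_inj; rewrite Ea Eb.
have {}Ek : kb = ka by exact: val_inj.
subst kb; congr existT; exact: val_inj.
Qed.

Lemma mxrank_jacobian_eval_map_le k (Z : k.-tuple input) (theta : params) :
  (forall z, z \in Z -> differentiable ((@realization R m n)^~ z) theta) ->
  (forall a : hidden, bias theta (tagged a) != 0) ->
  (\rank (jacobian (eval_map Z) theta) <= param_dim m n - #|hidden|)%N.
Proof.
move=> dZ b0; have := mulmx0_rank_max (scaling_dirs_jacobian dZ).
suff rk : (#|hidden| <= \rank (scaling_dirs theta))%N.
  move=> rkJ; rewrite leq_subRL; first exact: leq_trans (leq_add rk (leqnn _)) rkJ.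
  exact: leq_trans rk (rank_leq_col _).
apply: leq_trans (mxrankM_maxl _ hidden_biases).
rewrite scaling_dirs_biases mxrank_unit// unitmxE det_diag unitfE.
by apply/prodf_neq0 => a _; rewrite mxE.
Qed.

Definition bias_dir : params :=
  of_weights m (fun k => \matrix_(a, b) (b == n k :> nat)%:R).

(** A zero bias becomes [t], and a nonzero one stays nonzero as long as [t] is below its absolute
    value. *)
Lemma near_bias_neq0 (theta : params) :
  \forall t \near (0 : R)^'+, forall a : hidden,
    bias (t *: bias_dir + theta) (tagged a) != 0.
Proof.
apply: filter_forall => a.
have E t : bias (t *: bias_dir + theta) (tagged a) = t + bias theta (tagged a).
  have lt_k := ltnW (hidden_lt a).
  by rewrite /bias weight_line// !mxE /= addn0 eqxx mulr1.
have [b0|b0] := eqVneq (bias theta (tagged a)) 0.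
  by near=> t; rewrite E b0 addr0 gt_eqF.
near=> t; rewrite E addr_eq0; apply/eqP => tb.
have t0 : 0 < t by [].
have : t < `|bias theta (tagged a)|.
  by near: t; apply: nbhs_right_lt; rewrite normr_gt0.
by rewrite -normrN -tb gtr0_norm// ltxx.
Unshelve. all: by end_near. Qed.

(** The bound holds at [line t] for small [t > 0]. Derivatives at smooth points are continuous in
    the parameter, so the Jacobians converge and the bound passes to the limit. *)
Lemma mxrank_jacobian_eval_map k (Z : k.-tuple input) (theta : params) :
  (forall z, z \in Z -> param_smooth theta z) ->
  (\rank (jacobian (eval_map Z) theta) <= param_dim m n - #|hidden|)%N.
Proof.
move=> sZ; pose line (t : R) := t *: bias_dir + theta.
have cvg_line : line t @[t --> 0^'+] --> theta.
  have E : 0 *: bias_dir + theta = theta by rewrite scale0r add0r.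
  rewrite -[X in _ --> X]E; apply: cvgD; last exact: cvg_cst.
  by apply: cvgZr_tmp; apply: cvg_within_filter; exact: cvg_id.
have near_dZ : \forall t \near theta, forall z, z \in Z ->
    differentiable ((@realization R m n)^~ z) t.
  have H (i : 'I_k) := param_smooth_differentiable (sZ _ (mem_tnth i Z)).
  apply: filterS (filter_forall _ H) => t dt z /tnthP[i ->]; exact: dt.
have near_dline : \forall t \near (0 : R)^'+, forall z, z \in Z ->
    differentiable ((@realization R m n)^~ z) (line t) by exact: cvg_line near_dZ.
apply: (@mxrank_limit _ _ (0 : R)^'+ _ _ _
  (fun t => jacobian (eval_map Z) (line t))); last first.
  apply: filterS2 near_dline (near_bias_neq0 theta) => t dZ b0.
  exact: mxrank_jacobian_eval_map_le.
move=> a b; case/mxvec_indexP: b => i j.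
(* Jacobian entries are read as directional derivatives only where the evaluation is differentiable,
   which holds at [theta] and eventually along the line. *)
have jacE t : (forall z, z \in Z -> differentiable ((@realization R m n)^~ z) t) ->
    jacobian (eval_map Z) t a (mxvec_index i j) =
    ('D_(delta_mx 0 a) ((@realization R m n)^~ (tnth Z i)) t) j 0.
  by move=> dZ; rewrite -mul_jacobian_eval_map// -rowE [RHS]mxE.
have dZ0 : forall z, z \in Z -> differentiable ((@realization R m n)^~ z) theta.
  exact: nbhs_singleton near_dZ.
rewrite [X in _ --> X](jacE theta dZ0).
have near_jacE : \forall t \near 0^'+,
    ('D_(delta_mx 0 a) ((@realization R m n)^~ (tnth Z i)) (line t)) j 0 =
    jacobian (eval_map Z) (line t) a (mxvec_index i j).
  by apply: filterS near_dline => t dZ; rewrite (jacE _ dZ).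
apply: cvg_trans (near_eq_cvg near_jacE) _.
have cD := param_smooth_continuous_derive (sZ _ (mem_tnth i Z)) (v := delta_mx 0 a).
have cDline := cvg_comp _ _ cvg_line cD.
exact: (cvg_comp _ _ cDline (@coord_continuous R _ _ j 0 _)).
Qed.

End UpperBound.

(** * Lower bound: the staircase parameter *)

Lemma mx_lineE (R : realType) (a b : nat) (A B : 'M[R]_(a, b)) t i j :
  (A + t *: (B - A)) i j = A i j + t * (B i j - A i j).
Proof. by rewrite !mxE. Qed.

Lemma affine_mapD (R : realType) (a b : nat) (A : 'M[R]_(b, a + 1))
    (x d : 'cV[R]_a) j :
  affine_map A (x + d) j 0 =
  affine_map A x j 0 + \sum_(l < a) A j (lshift 1 l) * d l 0.
Proof.
rewrite !affine_mapE addrAC; congr (_ + _); rewrite -big_split /=.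
by apply: eq_bigr => l _; rewrite mxE mulrDr.
Qed.

Lemma affine_map_line (R : realType) (a b : nat) (A : 'M[R]_(b, a + 1))
    (h h' : 'cV[R]_a) (t : R) :
  affine_map A (h + t *: (h' - h)) =
  affine_map A h + t *: (affine_map A h' - affine_map A h).
Proof.
rewrite /affine_map -mulmxBr scalemxAr -mulmxDr; congr (_ *m _).
by rewrite opp_col_mx add_col_mx scale_col_mx add_col_mx subrr scaler0 addr0.
Qed.

(** * Masked networks along lines of inputs *)

Section MaskedNetwork.
Variables (R : realType) (m : nat) (n : nat -> nat).
Local Notation params := 'rV[R]_(param_dim m n).
Local Notation input := 'cV[R]_(n 0).

(** Once the mask is frozen, every layer is affine in the input. *)
Lemma mnet_line s (theta : params) (x y : input) t k :
  mnet s (theta, x + t *: (y - x)) k =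
  mnet s (theta, x) k + t *: (mnet s (theta, y) k - mnet s (theta, x) k).
Proof.
elim: k => [//|k IH]; apply/colP => j.
rewrite mx_lineE !mnetS /preact IH affine_map_line mx_lineE.
by move: (affine_map _ _) (affine_map _ _) => A B; ring.
Qed.

Lemma preact_line s (theta : params) (x y : input) t k :
  preact s (theta, x + t *: (y - x)) k =
  preact s (theta, x) k + t *: (preact s (theta, y) k - preact s (theta, x) k).
Proof. by rewrite /preact mnet_line affine_map_line. Qed.

Lemma cvg_input_line (theta : params) (x u : input) :
  (theta, x + t *: u) @[t --> (0 : R)^'+] --> (theta, x).
Proof.
have cx : x + t *: u @[t --> (0 : R)^'+] --> x.
  have E : x + 0 *: u = x by rewrite scale0r addr0.
  rewrite -[X in _ --> X]E; apply: cvgD; first exact: cvg_cst.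
  by apply: cvgZr_tmp; apply: cvg_within_filter; exact: cvg_id.
have cth : (fun _ : R => theta) @ (0 : R)^'+ --> theta by exact: cvg_cst.
exact: (@cvg_pair _ _ _ (0 : R)^'+ (nbhs theta) (nbhs x) _ _ _ _ _ cth cx).
Qed.

(** The base point may lie on a wall: a neuron either has the right strict sign at [x], kept by
    continuity, or acquires it as soon as [t > 0]. *)
Lemma near_pattern_line (s : nat -> nat -> bool) (theta : params) (x u : input) :
  (forall (k : 'I_m) (j : 'I_(n k.+1)),
    0 < signed (s k j) (preact s (theta, x) k j 0) \/
    forall t, 0 < t -> 0 < signed (s k j) (preact s (theta, x + t *: u) k j 0)) ->
  \forall t \near (0 : R)^'+, pattern s (theta, x + t *: u).
Proof.
move=> sx.
have near_sign (k : 'I_m) (j : 'I_(n k.+1)) : \forall t \near (0 : R)^'+,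
    0 < signed (s k j) (preact s (theta, x + t *: u) k j 0).
  have [pos|pos] := sx k j; last by near=> t; exact: pos.
  have cont : {for (theta, x : input),
      continuous (fun q => signed (s k j) (preact s q k j 0))}.
    rewrite /signed.
    have cont := polynomial_continuous (@polynomial_preact R m n s k j) (x := (theta, x)).
    by case: (s k j) => //; exact: continuousN.
  exact: (cvgr_gt _ (cvg_comp _ _ (@cvg_input_line theta x u) cont) _ pos).
exact: filter_forall _ (fun k => filter_forall _ (near_sign k)).
Unshelve. all: by end_near. Qed.

Lemma tangent_pattern s v (theta : params) (x : input) :
  pattern s (theta, x) ->
  tangent s v (theta, x) m = 'D_v ((@realization R m n)^~ x) theta.
Proof.
move=> sx; rewrite derive_realization -derive_mnet.
apply: near_eq_derive; apply: filterS (near_pattern sx) => p sp.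
by rewrite realizationE mnet_pattern.
Qed.

(** Inside the pattern the tangent is a derivative at a smooth point, hence zero. Being polynomial,
    it also vanishes at the boundary point [x], where the realization itself may fail to be
    differentiable. *)
Lemma tangent_boundary s v (theta : params) (x u : input) :
  (\forall t \near (0 : R)^'+, pattern s (theta, x + t *: u)) ->
  (forall y, param_smooth theta y -> 'D_v ((@realization R m n)^~ y) theta = 0) ->
  tangent s v (theta, x) m = 0.
Proof.
move=> near_s Dv0; apply/colP => j; rewrite [RHS]mxE.
pose f (p : params * input) := ('D_(v, 0) (mnet s ^~ m) p) j 0.
have cf : {for (theta, x), continuous f}.
  have pf := polynomial_map_derive (v, 0) (@polynomial_mnet R m n s m).
  exact: (polynomial_continuous (pf j)).
have cvg_f := cvg_comp _ _ (@cvg_input_line theta x u) cf.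
have cvg_0 : f (theta, x + t *: u) @[t --> (0 : R)^'+] --> (0 : R).
  have near0 : \forall t \near (0 : R)^'+, (0 : R) = f (theta, x + t *: u).
    apply: filterS near_s => t st.
    rewrite /f derive_mnet tangent_pattern// Dv0 ?mxE//.
    exact: pattern_param_smooth st.
  by apply: cvg_trans (near_eq_cvg near0) _; exact: cvg_cst.
by rewrite -derive_mnet; exact: (cvg_unique _ cvg_f cvg_0).
Qed.

Lemma tangent_eq0 s v (p : params * input) k :
  (forall i, (i < k)%N -> weight i v = 0) -> tangent s v p k = 0.
Proof.
elim: k => [//|k IH] v0; apply/colP => j.
rewrite tangentS IH; last by move=> i ik; apply: v0; exact: leqW.
by rewrite v0// /affine_map col_mx0 mul0mx mulmx0 addr0 !mxE mulr0.
Qed.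

End MaskedNetwork.

(** * The staircase parameter, its walls and its kernel *)

Section Staircase.
Variables (R : realType) (m : nat) (n : nat -> nat).
Hypothesis n_gt0 : forall i, (i <= m)%N -> (0 < n i)%N.
Hypothesis n_narrowing : narrowing m n.
Local Notation params := 'rV[R]_(param_dim m n).
Local Notation input := 'cV[R]_(n 0).

(** Each neuron reads the coordinate of its own index plus all the surplus ones, those of index at
    least [n k.+1]. The first part separates the neurons, the second leaves no column of weights
    zero, and the bias [-1] (in column [n k]) keeps the walls away from the origin. *)
Definition stair_theta : params :=
  of_weights m (fun k => \matrix_(a, b)
    if (b == n k :> nat) then -1 else ((b == a :> nat) || (n k.+1 <= b)%N)%:R).

Definition tail_sum k (h : 'cV[R]_(n k)) : R :=
  \sum_(l < n k | (n k.+1 <= l)%N) h l 0.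

Definition low k (lt_km : (k < m)%N) : 'I_(n k.+1) -> 'I_(n k) :=
  widen_ord (ltnW (n_narrowing lt_km)).

Lemma weight_stair k (lt_km : (k < m)%N) a l :
  weight k stair_theta a (lshift 1 l) = ((l == low lt_km a) || (n k.+1 <= l)%N)%:R.
Proof. by rewrite of_weightsK// mxE /= ltn_eqF. Qed.

Lemma bias_stair k a : (k < m)%N -> weight k stair_theta a (rshift (n k) 0) = -1.
Proof. by move=> lt_km; rewrite of_weightsK// mxE /= addn0 eqxx. Qed.

Lemma sum_weight_stair k (lt_km : (k < m)%N) a (h : 'cV[R]_(n k)) :
  \sum_(l < n k) weight k stair_theta a (lshift 1 l) * h l 0 =
  h (low lt_km a) 0 + tail_sum h.
Proof.
rewrite (bigD1 (low lt_km a))//= weight_stair eqxx mul1r; congr (_ + _).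
rewrite big_mkcond [RHS]big_mkcond; apply: eq_bigr => l _.
rewrite (weight_stair lt_km); have [->|] := eqVneq l (low lt_km a).
  by rewrite /= leqNgt ltn_ord.
by case: leqP; rewrite ?mul1r ?mul0r.
Qed.

Lemma affine_stair k (lt_km : (k < m)%N) (h : 'cV[R]_(n k)) a :
  affine_map (weight k stair_theta) h a 0 = h (low lt_km a) 0 + tail_sum h - 1.
Proof. by rewrite affine_mapE sum_weight_stair bias_stair. Qed.

Lemma tail_sum_ge k (h : 'cV[R]_(n k)) (l : 'I_(n k)) : (forall a, 0 <= h a 0) ->
  (n k.+1 <= l)%N -> h l 0 <= tail_sum h.
Proof.
by move=> h0 le_l; rewrite /tail_sum (bigD1 l)//= lerDl; apply: sumr_ge0.
Qed.

Lemma tail_sum_ge0 k (h : 'cV[R]_(n k)) : (forall a, 0 <= h a 0) -> 0 <= tail_sum h.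
Proof. by move=> h0; apply: sumr_ge0. Qed.

(* Since [n k > n k.+1], small positive values on the last coordinates leave
   room for any nonnegative target. *)
Lemma affine_stair_surj k (y : 'cV[R]_(n k.+1)) : (k < m)%N ->
  (forall a, 0 <= y a 0) ->
  exists h : 'cV[R]_(n k),
    (forall l, 0 < h l 0) /\ affine_map (weight k stair_theta) h = y.
Proof.
move=> lt_km y0; pose c : R := (n k).+1%:R^-1.
(* The low coordinates solve the equation once [e] is the tail sum, which does not depend on [e].
   With at most [n k] terms equal to [1 / (n k + 1)], the tail sum is below 1, so the low
   coordinates are positive. *)
pose h e : 'cV[R]_(n k) :=
  \col_(l < n k) if insub (l : nat) is Some a then y a 0 + 1 - e else c.
have hE e e' : tail_sum (h e) = tail_sum (h e').
  apply: eq_bigr => l le_l; rewrite !mxE insubF//.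
  by apply/negbTE; rewrite -leqNgt.
pose e := tail_sum (h 0).
have lt_e1 : e < 1.
  have : e <= \sum_(l < n k) c.
    rewrite /e /tail_sum big_mkcond; apply: ler_sum => l _.
    case: leqP => [le_l|_]; last by rewrite invr_ge0.
    by rewrite mxE insubF//; apply/negbTE; rewrite -leqNgt.
  move=> /le_lt_trans; apply; rewrite sumr_const card_ord -[ltLHS]mulr_natl.
  by rewrite ltr_pdivrMr ?mul1r ?ltr_nat.
exists (h e); split=> [l|].
  rewrite mxE; case: insubP => [a _ _|_]; last by rewrite invr_gt0 ltr0n.
  by have := y0 a; lra.
apply/colP => a; rewrite (affine_stair lt_km) (hE e 0) -/e mxE.
rewrite insubT /=; first exact: ltn_ord.
move=> lt_a; rewrite (_ : Sub _ _ = a); last exact: val_inj.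
by ring.
Qed.

(** Preimages are chosen backwards, layer by layer. A single [x] serves every mask that is on below
    layer [k], so both sides of a wall can be compared at the same input. *)
Lemma stair_realize k (h : 'cV[R]_(n k)) : (k <= m)%N -> (forall a, 0 < h a 0) ->
  exists x : input, forall s : nat -> nat -> bool,
    (forall i (j : 'I_(n i.+1)), (i < k)%N -> s i j) ->
    mnet s (stair_theta, x) k = h /\
    forall i (j : 'I_(n i.+1)), (i < k)%N -> 0 < preact s (stair_theta, x) i j 0.
Proof.
elim: k h => [|k IH] h le_km h0; first by exists h.
have [h' [h'0 h'E]] := affine_stair_surj le_km (fun a => ltW (h0 a)).
have [x xP] := IH h' (ltnW le_km) h'0; exists x => s sT.
have [|mE pos] := xP s; first by move=> i j ik; apply: sT; exact: leqW.
have preE : preact s (stair_theta, x) k = h by rewrite /preact mE.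
split=> [|i j].
  by apply/colP => a; rewrite mnetS preE sT// mul1r.
by rewrite ltnS leq_eqVlt => /orP[/eqP ik|/pos//]; subst i; rewrite preE.
Qed.

(** Tolerates one zero coordinate, the output of the neuron on its wall, and still gives
    pre-activations of at least [2 - 1 = 1] in the next layer: each neuron reads its own coordinate
    and the last one, which differ. *)
Definition spread k (h : 'cV[R]_k) :=
  (forall a, 0 <= h a 0) /\ (forall a b, a != b -> 2 <= h a 0 + h b 0).

Lemma affine_stair_spread k (h : 'cV[R]_(n k)) a : (k < m)%N -> spread h ->
  1 <= affine_map (weight k stair_theta) h a 0.
Proof.
move=> lt_km [h0 h2]; rewrite (affine_stair lt_km).
have lt_l : ((n k).-1 < n k)%N by rewrite prednK// n_gt0// ltnW.
have le_l : (n k.+1 <= Ordinal lt_l)%N.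
  by rewrite /= -ltnS prednK; [exact: n_narrowing|rewrite n_gt0// ltnW].
have := tail_sum_ge h0 le_l; have := h2 (low lt_km a) (Ordinal lt_l).
have -> : low lt_km a != Ordinal lt_l.
  by rewrite -val_eqE ltn_eqF//; exact: leq_trans (ltn_ord a) le_l.
by move=> /(_ isT); lra.
Qed.

(** After one layer all activations are at least 1, so any two add up to at least 2 and the
    condition propagates. *)
Lemma mnet_stair_spread (s : nat -> nat -> bool) (x : input) k : (k <= m)%N ->
  (forall i (j : 'I_(n i.+1)), (k <= i)%N -> s i j) ->
  spread (mnet s (stair_theta, x) k) ->
  forall i (j : 'I_(n i.+1)), (k <= i < m)%N -> 1 <= preact s (stair_theta, x) i j 0.
Proof.
move=> le_km sT sp i j /andP[le_ki lt_im].
suff : spread (mnet s (stair_theta, x) i) by move/affine_stair_spread; exact.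
elim: i le_ki lt_im {j} => [|i IH]; first by rewrite leqn0 => /eqP k0; subst k.
rewrite leq_eqVlt => /orP[/eqP ik _|le_ki lt_im]; first by subst k.
have {}IH := IH le_ki (ltnW lt_im).
have h1 a : 1 <= mnet s (stair_theta, x) i.+1 a 0.
  by rewrite mnetS sT// mul1r; exact: affine_stair_spread (ltnW lt_im) IH.
split=> [a|a b _]; first exact: le_trans (h1 a).
by have := h1 a; have := h1 b; lra.
Qed.

(** The masks on the two sides of the wall of neuron [j] of layer [k], all other neurons being
    on. *)
Definition wall_mask (b : bool) (k j k' j' : nat) : bool :=
  b || ~~ ((k' == k) && (j' == j)).

Lemma wall_mask_neq b k j k' j' : (k', j') != (k, j) -> wall_mask b k j k' j'.
Proof. by rewrite xpair_eqE /wall_mask => ->; rewrite orbT. Qed.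

Lemma wall_mask_eq b k j : wall_mask b k j k j = b.
Proof. by rewrite /wall_mask !eqxx orbF. Qed.

(** * The jump of the derivative across a wall *)

Section Wall.
Variables (v : params) (k : nat) (j : 'I_(n k.+1)).
Variable (x : input).
Let p := (stair_theta, x).
Let s b := wall_mask b k j.
Hypothesis v0 : forall i, (i < k)%N -> weight i v = 0.
Hypothesis on_wall : preact (s true) p k j 0 = 0.

(** On its wall, the switching neuron outputs zero under either mask. *)
Lemma mnet_wall l : mnet (s false) p l = mnet (s true) p l.
Proof.
elim: l => [//|l IH]; apply/colP => a; rewrite !mnetS /preact IH.
have [E|neq] := eqVneq (l, a : nat) (k, j : nat); last by rewrite /s !wall_mask_neq.
move: on_wall; rewrite /preact; case: E => El; subst l => /val_inj ->.
by move=> ->; rewrite !mulr0.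
Qed.

(* The jump of the derivative across the wall of neuron [j] of layer [k] is
   transported to the output by matrices with nonnegative entries and no zero
   column. *)
Lemma tangent_wall l : (k < l <= m)%N -> exists g : 'cV[R]_(n l),
  [/\ forall a, 0 <= g a 0, exists a, 0 < g a 0 &
  tangent (s true) v p l = tangent (s false) v p l +
    affine_map (weight k v) (mnet (s true) p k) j 0 *: g].
Proof.
set c := affine_map _ _ _ _.
elim: l => [//|l IH]; rewrite ltnS leq_eqVlt => /andP[/orP[/eqP kl|lt_kl] le_lm].
  (* As [v] vanishes below layer [k], the input of that layer has zero tangent, and the masks differ
     only by the variation of row [j]. *)
  subst l; exists (delta_mx j 0); split.
  - by move=> a; rewrite mxE ler0n.
  - by exists j; rewrite mxE !eqxx ltr01.
  apply/colP => a; rewrite tangentS [RHS]mxE tangentS mnet_wall !tangent_eq0//.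
  rewrite col_mx0 mulmx0 addr0 [X in _ = _ + X]mxE [X in _ = _ + _ * X]mxE eqxx andbT.
  have [->|neq] := eqVneq a j.
    by rewrite /s !wall_mask_eq mul1r mul0r add0r mulr1.
  by rewrite mulr0 addr0 /s !wall_mask_neq// xpair_eqE negb_and neq orbT.
have [|g [g0 [a0 ga0] gE]] := IH; first by rewrite lt_kl ltnW.
pose g' := weight l stair_theta *m col_mx g 0.
have g'E a : g' a 0 = g (low le_lm a) 0 + tail_sum g.
  by rewrite mulmx_col_mx0E sum_weight_stair.
exists g'; split.
- by move=> a; rewrite g'E addr_ge0// tail_sum_ge0.
(* A low coordinate [a0] feeds the neuron of the same index; a surplus one feeds all neurons, in
   particular neuron 0. *)
- have [lt_a|le_a] := ltnP a0 (n l.+1).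
    exists (Ordinal lt_a); rewrite g'E ltr_wpDr// ?tail_sum_ge0//.
    by rewrite (_ : low _ _ = a0)//; exact: val_inj.
  exists (Ordinal (n_gt0 le_lm)); rewrite g'E ltr_wpDl//.
  by apply: lt_le_trans ga0 _; exact: tail_sum_ge.
apply/colP => a; rewrite tangentS [RHS]mxE tangentS mnet_wall gE.
have neq : (l, a : nat) != (k, j : nat) by rewrite xpair_eqE gtn_eqF.
rewrite /s !wall_mask_neq// !mul1r -[X in col_mx (_ + _) X](addr0 0) -add_col_mx.
rewrite -[X in col_mx (_ *: _) X](scaler0 _ c) -scale_col_mx mulmxDr -scalemxAr.
by rewrite addrA mxE.
Qed.

End Wall.

Definition in_kernel (v : params) :=
  forall y, param_smooth stair_theta y ->
    'D_v ((@realization R m n)^~ y) stair_theta = 0.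

(** An input [x] producing [h] lies on the wall of neuron [j] and on no other. Both one-sided
    tangents at [x] vanish, so their difference does, and it is the claimed quantity times a nonzero
    vector. *)
Lemma stair_wall (v : params) k (j : 'I_(n k.+1)) (h : 'cV[R]_(n k)) :
  (k < m)%N -> in_kernel v ->
  (forall i, (i < k)%N -> weight i v = 0) -> (forall l, 0 < h l 0) ->
  affine_map (weight k stair_theta) h j 0 = 0 ->
  (forall a, a != j -> 2 <= affine_map (weight k stair_theta) h a 0) ->
  affine_map (weight k v) h j 0 = 0.
Proof.
(* Raising the own coordinate of neuron [j] by 1 takes its pre-activation from 0 to 1, so the line
   from [x] to [y] crosses the wall. *)
move=> lt_km kv v0 h0 hj0 h2; pose h' := h + delta_mx (low lt_km j) 0.
have h'0 l : 0 < h' l 0 by rewrite mxE ltr_wpDr// mxE ler0n.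
have h'j1 : affine_map (weight k stair_theta) h' j 0 = 1.
  have tE : tail_sum h' = tail_sum h.
    apply: eq_bigr => l le_l; rewrite mxE [X in _ + X]mxE andbT.
    rewrite -val_eqE gtn_eqF ?addr0//; exact: leq_trans (ltn_ord j) le_l.
  have h'E : h' (low lt_km j) 0 = h (low lt_km j) 0 + 1.
    by rewrite mxE [X in _ + X]mxE !eqxx.
  by move: hj0; rewrite !(affine_stair lt_km) tE h'E; lra.
have [x xP] := stair_realize (ltnW lt_km) h0.
have [y yP] := stair_realize (ltnW lt_km) h'0.
pose s b := wall_mask b k j.
have sT b i (a : 'I_(n i.+1)) : (i < k)%N -> s b i a.
  by move=> lt_ik; rewrite /s wall_mask_neq// xpair_eqE ltn_eqF.
have px b : preact (s b) (stair_theta, x) k = affine_map (weight k stair_theta) h.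
  by rewrite /preact (xP (s b) (sT b)).1.
have py b : preact (s b) (stair_theta, y) k = affine_map (weight k stair_theta) h'.
  by rewrite /preact (yP (s b) (sT b)).1.
have t0 b : tangent (s b) v (stair_theta, x) m = 0.
  (* Towards [y] neuron [j] turns on, away from [y] it turns off. *)
  apply: (tangent_boundary (u := (if b then 1 else -1) *: (y - x))) kv.
  apply: near_pattern_line => i a; have [lt_ik|lt_ki|ik] := ltngtP i k.
  - by left; rewrite sT//; exact: (xP (s b) (sT b)).2.
  - left; rewrite /s wall_mask_neq ?xpair_eqE ?(gtn_eqF lt_ki)//=.
    apply: lt_le_trans ltr01 _; apply: (mnet_stair_spread (k := k.+1)) => //.
    + move=> i' j' lt_ki'; rewrite wall_mask_neq// xpair_eqE gtn_eqF//.
    (* Layer [k.+1] outputs 0 at [j] and at least 2 elsewhere, hence is spread. *)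
    + have mE c : mnet (s b) (stair_theta, x) k.+1 c 0 =
          if c == j then 0 else affine_map (weight k stair_theta) h c 0.
        rewrite mnetS px; case: eqVneq => [->|neq]; first by rewrite hj0 mulr0.
        by rewrite /s wall_mask_neq ?mul1r// xpair_eqE negb_and neq orbT.
      split=> [c|c d].
        by rewrite mE; case: eqVneq => // neq; exact: le_trans (h2 c neq).
      move=> cd; rewrite !mE; have [cj|cj] := eqVneq c j.
        by rewrite eq_sym -cj (negbTE cd) add0r h2// -cj eq_sym.
      have [dj|dj] := eqVneq d j; first by rewrite addr0 h2.
      by have := h2 c cj; have := h2 d dj; lra.
    + by rewrite lt_ki ltn_ord.
  - move: a; rewrite ik => a.
    have [->|neq] := eqVneq a j; last first.
      left; rewrite /s wall_mask_neq ?xpair_eqE ?negb_and ?neq ?orbT//=.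
      by rewrite px; exact: lt_le_trans (h2 a neq).
    right => t t_gt0; rewrite scalerA preact_line mx_lineE px py hj0 h'j1.
    by rewrite /s wall_mask_eq; case: b; rewrite /signed; lra.
have wall : preact (s true) (stair_theta, x) k j 0 = 0 by rewrite px.
have [|g [_ [a ga] /eqP]] := tangent_wall v0 wall (l := m).
  by rewrite lt_km leqnn.
rewrite !t0 add0r eq_sym => /eqP/colP/(_ a)/eqP; rewrite mxE [X in _ == X]mxE.
by rewrite mulf_eq0 (gt_eqF ga) orbF (xP (s true) (sT true)).1 => /eqP.
Qed.

(** Small moves along the wall show that the row [a] of [v] is a multiple of the staircase row [w].
    On the wall the scalar product of [w] and [h] is 1, so with zero bias variation the factor is
    the value of the vanishing form at [h e]. *)
Lemma stair_row_eq0 (v : params) k (j : 'I_(n k.+1)) :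
  (k < m)%N -> in_kernel v ->
  (forall i, (i < k)%N -> weight i v = 0) ->
  weight k v j (rshift (n k) 0) = 0 ->
  forall l, weight k v j (lshift 1 l) = 0.
Proof.
move=> lt_km kv v0 vb0.
have wall h := @stair_wall v k j h lt_km kv v0.
pose a l : R := weight k v j (lshift 1 l).
pose w l : R := weight k stair_theta j (lshift 1 l).
have w01 l : w l = 0 \/ w l = 1.
  by rewrite /w (weight_stair lt_km); case: (_ || _); [right|left].
pose c : R := (n k).+1%:R^-1.
have c_gt0 : 0 < c by rewrite invr_gt0 ltr0n.
(* [h e] lies on the wall of neuron [j] when [e] is the tail sum of [h e], which
   does not depend on [e]. *)
pose h e : 'cV[R]_(n k) :=
  \col_l (if l == low lt_km j then 1 - e else if (n k.+1 <= l)%N then c else 3).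
have hE e e' : tail_sum (h e) = tail_sum (h e').
  apply: eq_bigr => l le_l; rewrite !mxE -val_eqE gtn_eqF//.
  exact: leq_trans (ltn_ord j) le_l.
pose e := tail_sum (h 0).
(* The tail omits the own coordinate of [j], so it has at most [n k - 1] terms equal to [c]. The own
   coordinate [1 - e] is thus at least [c], which is the room allowed in [pos]. *)
have le_e : e <= 1 - c.
  have : e <= \sum_(l < n k | l != low lt_km j) c.
    rewrite /e /tail_sum [leLHS]big_mkcond [leRHS]big_mkcond; apply: ler_sum => l _.
    rewrite mxE; have [->|neq] := eqVneq l (low lt_km j).
      by rewrite leqNgt /= ltn_ord.
    by case: leqP => // _; exact: ltW.
  have -> : \sum_(l < n k | l != low lt_km j) c = (n k).-1%:R * c.
    by have := cardC1 (low lt_km j); rewrite card_ord => <-; rewrite mulr_natl sumr_const.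
  have -> : 1 - c = (n k)%:R * c.
    have : (n k).+1%:R * c = 1 by rewrite /c mulfV// pnatr_eq0.
    by rewrite -natr1 mulrDl mul1r => E; rewrite -[X in X - c]E addrK.
  by move=> /le_trans; apply; rewrite ler_pM2r// ler_nat leq_pred.
have pos (d : 'cV[R]_(n k)) : (forall l, 0 <= d l 0 \/ l = low lt_km j /\ - c < d l 0) ->
    forall l, 0 < (h e + d) l 0.
  move=> dP l; rewrite mxE [X in X + _]mxE; case: eqVneq => [->|neq].
    by have [?|[_ ?]] := dP (low lt_km j); lra.
  case: (dP l) => [d0|[E]]; last by rewrite E eqxx in neq.
  by case: ifP => _; lra.
have he0 : 0 <= e.
  apply: sumr_ge0 => l le_l; rewrite mxE -val_eqE gtn_eqF ?le_l ?ltW//.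
  exact: leq_trans (ltn_ord j) le_l.
have he_j : affine_map (weight k stair_theta) (h e) j 0 = 0.
  by rewrite (affine_stair lt_km) (hE e 0) -/e mxE eqxx; ring.
(* The entry [3] yields [3 + e - 1], at least 2 since [e] is nonnegative. *)
have he_a b : b != j -> 2 <= affine_map (weight k stair_theta) (h e) b 0.
  move=> bj; rewrite (affine_stair lt_km) (hE e 0) -/e mxE.
  have -> : low lt_km b == low lt_km j = false.
    by apply/negbTE; rewrite -val_eqE.
  by rewrite leqNgt /= ltn_ord /=; lra.
have f0 : affine_map (weight k v) (h e) j 0 = 0.
  have /wall : forall l, 0 < h e l 0.
    move=> l; rewrite -[h e]addr0; apply: pos => l'; left; rewrite mxE //.
  exact.
have alE l : l != low lt_km j -> a l = w l * a (low lt_km j).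
  (* A direction tangent to the wall. The factor [c / 2] keeps the activations positive, and the
     other neurons, which do not read [low lt_km j], can only increase. *)
  move=> lj; pose d : 'cV[R]_(n k) :=
    (c / 2) *: (delta_mx l 0 - w l *: delta_mx (low lt_km j) 0).
  have dE i : d i 0 = c / 2 * ((i == l)%:R - w l * (i == low lt_km j)%:R).
    by rewrite !mxE !andbT.
  have sumE (u : 'I_(n k) -> R) : \sum_(i < n k) u i * d i 0 =
      c / 2 * (u l - w l * u (low lt_km j)).
    under eq_bigr do rewrite dE.
    rewrite (bigD1 l)//= (bigD1 (low lt_km j))//=; last by rewrite eq_sym.
    rewrite big1 ?addr0; last first.
      by move=> i /andP[/negbTE -> /negbTE ->]; rewrite mulr0 subrr !mulr0.
    by rewrite !eqxx [low lt_km j == l]eq_sym (negbTE lj) mulr0n mulr1n; ring.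
  have : affine_map (weight k v) (h e + d) j 0 = 0.
    apply: wall.
    - apply: pos => i; rewrite dE; case: (eqVneq i l) => [->|il].
        left; rewrite (negbTE lj) mulr0 subr0 mulr1; lra.
      case: (eqVneq i (low lt_km j)) => [->|ij]; last by left; rewrite mulr0 subrr mulr0.
      by right; split=> //; rewrite mulr1 sub0r; case: (w01 l) => ->; lra.
    - rewrite affine_mapD he_j add0r sumE -/(w _) -/(w _).
      have -> : w (low lt_km j) = 1 by rewrite /w weight_stair eqxx.
      by rewrite mulr1 subrr mulr0.
    - move=> b bj; rewrite affine_mapD sumE.
      have -> : weight k stair_theta b (lshift 1 (low lt_km j)) = 0.
        rewrite (weight_stair lt_km) -val_eqE /= eq_sym (negbTE (_ : val b != val j))//.
        by rewrite leqNgt ltn_ord.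
      rewrite mulr0 subr0 (le_trans (he_a b bj))// lerDl.
      by rewrite (weight_stair lt_km) mulr_ge0// ltW// divr_gt0.
  rewrite affine_mapD f0 add0r sumE => /eqP; rewrite mulf_eq0 gt_eqF ?divr_gt0//=.
  by rewrite subr_eq0 => /eqP.
have aE l : a l = w l * a (low lt_km j).
  have [->|] := eqVneq l (low lt_km j); last exact: alE.
  by rewrite /w weight_stair eqxx mul1r.
have a0 : a (low lt_km j) = 0.
  move: f0; rewrite affine_mapE vb0 addr0.
  under eq_bigr do rewrite -/(a _) aE mulrAC.
  rewrite -big_distrl /= => /eqP; rewrite mulf_eq0 => /orP[|/eqP//].
  move: he_j; rewrite affine_mapE bias_stair// => /eqP; rewrite subr_eq0 => /eqP ->.
  by rewrite oner_eq0.
by move=> l; rewrite -/(a l) aE a0 mulr0.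
Qed.

(** When the activations of layer [k] are at least 2, all neurons, outputs included, are on and the
    tangent is the affine map of [v]. Its vanishing at all such points forces the weights, then the
    biases, to vanish. *)
Lemma stair_last_eq0 (v : params) k : m = k.+1 -> in_kernel v ->
  (forall i, (i < k)%N -> weight i v = 0) -> weight k v = 0.
Proof.
move=> mk kv v0; have lt_km : (k < m)%N by rewrite mk.
have aff0 (h : 'cV[R]_(n k)) : (forall l, 2 <= h l 0) -> affine_map (weight k v) h = 0.
  move=> h2; have h0 l : 0 < h l 0 by have := h2 l; lra.
  have [x xP] := stair_realize (ltnW lt_km) h0.
  have [|mE pos] := xP (fun _ _ => true); first by [].
  have : pattern (fun _ _ => true) (stair_theta, x).
    move=> i j; rewrite /signed.
    have [lt_ik|] := ltnP i k; first exact: pos.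
    move=> le_ki; have ik : i = k :> nat.
      by apply/eqP; rewrite eqn_leq le_ki andbT -ltnS -mk.
    move: j; rewrite ik => j; rewrite /preact mE (affine_stair lt_km).
    by have := tail_sum_ge0 (fun a => ltW (h0 a)); have := h2 (low lt_km j); lra.
  move=> sx; have /colP t0 : tangent (fun _ _ => true) v (stair_theta, x) k.+1 = 0.
    by rewrite -mk tangent_pattern//; exact: kv (pattern_param_smooth sx).
  apply/colP => j; have := t0 j.
  by rewrite tangentS tangent_eq0// col_mx0 mulmx0 addr0 mE mul1r.
have aff2 : affine_map (weight k v) (const_mx 2) = 0.
  by apply: aff0 => l; rewrite mxE.
have wl0 l j : weight k v j (lshift 1 l) = 0.
  have /aff0/colP/(_ j) : forall i, 2 <= (const_mx 2 + delta_mx l 0 : 'cV[R]_(n k)) i 0.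
    by move=> i; rewrite mxE [X in X + _]mxE [X in _ + X]mxE lerDl ler0n.
  rewrite affine_mapD aff2 [X in X + _]mxE add0r [RHS]mxE (bigD1 l)//=.
  rewrite mxE !eqxx mulr1 big1 ?addr0// => i il.
  by rewrite mxE (negbTE il) mulr0.
apply/matrixP => j l; rewrite [RHS]mxE; case: (split_ordP l) => i ->.
  exact: wl0.
move: aff2 => /colP/(_ j); rewrite affine_mapE [RHS]mxE big1 ?add0r ?ord1//.
by move=> l' _; rewrite wl0 mul0r.
Qed.

Lemma stair_kernel_eq0 (v : params) : in_kernel v ->
  (forall k (j : 'I_(n k.+1)), (k.+1 < m)%N -> weight k v j (rshift (n k) 0) = 0) ->
  v = 0.
Proof.
move=> kv vb0; apply: (@weight_inj R m n) => k lt_km; rewrite linear0.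
elim/ltn_ind: k lt_km => k IH lt_km.
have v0 i : (i < k)%N -> weight i v = 0.
  by move=> lt_ik; apply: IH => //; exact: ltn_trans lt_km.
have := lt_km; rewrite leq_eqVlt => /orP[/eqP mk|lt_k1m].
  exact: stair_last_eq0.
apply/matrixP => j l; rewrite mxE; case: (split_ordP l) => i ->.
  by apply: stair_row_eq0 => //; exact: vb0.
by rewrite ord1 vb0.
Qed.

End Staircase.

(** * The functional dimension *)

(** As long as the subspace is nonzero, some [x] fails to kill it, and intersecting with the kernel
    of [L x] lowers its dimension; finitely many points suffice. *)
Lemma finite_common_kernel (F : fieldType) (T : choiceType) (D q : nat)
    (X : T -> Prop) (L : T -> 'M[F]_(D, q)) (K : 'M[F]_D) :
  (forall v : 'rV[F]_D, (v <= K)%MS -> (forall x, X x -> v *m L x = 0) -> v = 0) ->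
  exists Z : seq T, [/\ uniq Z, forall z, z \in Z -> X z &
    forall v : 'rV[F]_D, (v <= K)%MS ->
      (forall z, z \in Z -> v *m L z = 0) -> v = 0].
Proof.
have [r] := ubnP (\rank K); elim: r K => // r IH K; rewrite ltnS => rK HK.
have [K0|/rowV0Pn[v vK v0]] := eqVneq K 0.
  by exists [::]; split=> // v; rewrite K0 submx0 => /eqP.
have [x Xx vLx] : exists2 x, X x & v *m L x != 0.
  apply: contrapT => nex; move/eqP: v0; apply; apply: HK => // x Xx.
  by apply/eqP; apply: contrapT => /negP vLx; apply: nex; exists x.
have ltK : (K :&: kermx (L x) < K)%MS.
  rewrite ltmxE capmxSl /=; apply: contra vLx => sK.
  by apply/eqP/sub_kermxP; apply: submx_trans vK (submx_trans sK (capmxSr _ _)).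
have [|v'|Z [uZ XZ HZ]] := IH (K :&: kermx (L x))%MS.
- exact: leq_trans (rank_ltmx ltK) rK.
- by rewrite sub_capmx => /andP[v'K _]; exact: HK.
exists (undup (x :: Z)); split; first exact: undup_uniq.
  by move=> z; rewrite mem_undup inE => /orP[/eqP->|/XZ].
move=> u uK uZ0; apply: HZ => [|z zZ].
  by rewrite sub_capmx uK; apply/sub_kermxP/uZ0; rewrite mem_undup mem_head.
by apply: uZ0; rewrite mem_undup inE zZ orbT.
Qed.

Lemma card_hidden m n : #|hidden m n| = (\sum_(i < m.-1) n i.+1)%N.
Proof.
rewrite card_tagged sumnE big_map big_enum /=.
by apply: eq_bigr => i _; rewrite card_ord.
Qed.

(** The hidden layers have one bias per hidden neuron; the output biases give the term [n m]. *)
Lemma param_dimE m n : (0 < m)%N ->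
  param_dim m n = (n m + \sum_(0 <= i < m) n i * n i.+1 + #|hidden m n|)%N.
Proof.
case: m => // m _; rewrite card_hidden.
have -> : param_dim m.+1 n = (\sum_(i < m.+1) (n i * n i.+1 + n i.+1))%N.
  apply: eq_bigr => i _.
  by rewrite -[LHS]/(n i.+1 * (n i + 1))%N mulnDr muln1 mulnC.
rewrite big_split /= [X in (_ + X)%N]big_ord_recr /= big_mkord.
by rewrite addnA addnC addnA.
Qed.

Section LowerBound.
Variables (R : realType) (m : nat) (n : nat -> nat).
Hypothesis n_gt0 : forall i, (i <= m)%N -> (0 < n i)%N.
Hypothesis n_narrowing : narrowing m n.
Local Notation params := 'rV[R]_(param_dim m n).
Local Notation input := 'cV[R]_(n 0).
Local Notation theta0 := (stair_theta R m n).

(** Directions fixing the hidden biases form a space of dimension at least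
    [param_dim m n - #|hidden m n|]. For a suitable finite [Z] this space meets the kernel of the
    Jacobian trivially, so the rank is at least its dimension. *)
Lemma stair_mxrank : exists k (Z : k.-tuple input),
  [/\ uniq Z, forall z, z \in Z -> param_smooth theta0 z &
  (param_dim m n - #|hidden m n| <= \rank (jacobian (eval_map Z) theta0))%N].
Proof.
pose L (z : input) := jacobian (eval_map [tuple z]) theta0.
have diff z : param_smooth theta0 z ->
    differentiable ((@realization R m n)^~ z) theta0.
  by move=> /param_smooth_differentiable; exact: nbhs_singleton.
have LE z v : param_smooth theta0 z ->
    (v *m L z = 0) <-> ('D_v ((@realization R m n)^~ z) theta0 = 0).
  move=> sz.
  have dz z' : z' \in [tuple z] -> differentiable ((@realization R m n)^~ z') theta0.
    by rewrite inE => /eqP ->; exact: diff.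
  split=> [/rowP v0|/colP v0].
    apply/colP => j; have := v0 (mxvec_index ord0 j).
    by rewrite mul_jacobian_eval_map// !mxE.
  apply/rowP => a; case/mxvec_indexP: a => i j.
  by rewrite mul_jacobian_eval_map// ord1 v0 !mxE.
have [v vK v0|Z [uZ sZ HZ]] :=
    @finite_common_kernel _ _ _ _ (@param_smooth R m n theta0) L
      (kermx (@hidden_biases R m n)).
  apply: (stair_kernel_eq0 n_gt0 n_narrowing) => [z sz|k j lt_km].
    by apply/(LE z v sz); exact: v0.
  have lt_k : (k < m.-1)%N by rewrite ltn_predRL.
  pose a : hidden m n :=
    Tagged (fun k : 'I_m.-1 => 'I_(n k.+1)) (j : 'I_(n (Ordinal lt_k).+1)).
  have /sub_kermxP/rowP/(_ (enum_rank a)) := vK.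
  by rewrite mul_hidden_biases enum_rankK mxE.
exists (size Z), (in_tuple Z); split=> //.
set J := jacobian _ _.
have KJ0 : (kermx (@hidden_biases R m n) :&: kermx J)%MS = 0.
  apply/eqP/rowV0P => v; rewrite sub_capmx => /andP[vK /sub_kermxP vJ].
  apply: HZ => // z zZ; apply/(LE z v (sZ z zZ)).
  have /tnthP[i ->] : z \in in_tuple Z by [].
  apply/colP => j; rewrite mxE -mul_jacobian_eval_map -/J ?vJ ?mxE//.
  by move=> z' z'Z; exact/diff/sZ.
have := mxrank_mul_ker (kermx (@hidden_biases R m n)) J.
rewrite KJ0 mxrank0 addn0 mxrank_ker => rE.
apply: leq_trans (mxrankM_maxr (kermx (@hidden_biases R m n)) J); rewrite rE.
by apply: leq_sub2l; exact: rank_leq_col.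
Qed.

End LowerBound.

Theorem theorem8p11 (R : realType) (m : nat) (n : nat -> nat)
    (n_arch : architecture m n) (n_narrowing : narrowing m n) :
  dim_fun_space R m n = ((n m + \sum_(0 <= i < m) n i * n i.+1)%N%:R)%:E.
Proof.
have [m_gt0 n_gt0] := n_arch.
have DE : (param_dim m n - #|hidden m n| =
    n m + \sum_(0 <= i < m) n i * n i.+1)%N by rewrite param_dimE// addnK.
rewrite -DE; apply/eqP; rewrite eq_le; apply/andP; split.
  apply: ge_ereal_sup => _ [theta _ <-].
  apply: ge_ereal_sup => _ [k [Z [_ sZ ->]]].
  by rewrite lee_fin ler_nat; exact: mxrank_jacobian_eval_map.
have [k [Z [uZ sZ rZ]]] := stair_mxrank R n_gt0 n_narrowing.
have ordinary0 : ordinary (stair_theta R m n).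
  (* With no points the Jacobian would have no columns, whereas its rank is at least [n m > 0]; so
     [Z] supplies a smooth point. *)
  have k_gt0 : (0 < k)%N.
    rewrite lt0n; apply/eqP => k0.
    move: rZ; rewrite DE => /leq_trans/(_ (rank_leq_col _)).
    by rewrite k0 mul0n leqn0 addn_eq0 eqn0Ngt n_gt0.
  by exists (tnth Z (Ordinal k_gt0)); apply: sZ; exact: mem_tnth.
apply: (@le_trans _ _ (dim_fun (stair_theta R m n))); last first.
  by apply: ereal_sup_ubound; exists (stair_theta R m n).
apply: le_trans (_ : (\rank (jacobian (eval_map Z) (stair_theta R m n)))%:R%:E <= _)%E.
  by rewrite lee_fin ler_nat.
by apply: ereal_sup_ubound; exists k, Z.
Qed.
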